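(* One has $\mathfrak h=[\mathfrak q,\mathfrak q]$, where $[\mathfrak q,\mathfrak q]$ is the linear span of all brackets $[X,Y]$ with $X,Y\in\mathfrak q$.
   Context: Let $l\ge 3$. Let $G=SO(2,l-1)$ act on $\mathbb R^{2,l-1}$ (two positive and $l-1$ negative directions), let $H=SO(1,l-1)\subset G$ be the stabilizer of a vector of square norm $+1$ (identity components), and let $\mathfrak g=\mathfrak{so}(2,l-1)$, $\mathfrak h=\mathfrak{so}(1,l-1)$ be their Lie algebras. Let $\sigma$ be the involutive automorphism of $\mathfrak g$ whose $+1$-eigenspace is $\mathfrak h$, and let $\mathfrak q$ be its $-1$-eigenspace, so that $\mathfrak g=\mathfrak h\oplus\mathfrak q$ is a reductive decomposition. *)

(* Defs.v *)
(* World: MathComp + MathComp-Analysis. *)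
From mathcomp Require Import all_boot all_order all_algebra.
From mathcomp Require Import all_classical all_reals all_analysis.
Import Order.TTheory GRing.Theory Num.Theory.
Import numFieldNormedType.Exports.

Set Implicit Arguments.
Unset Strict Implicit.
Unset Printing Implicit Defensive.

Local Open Scope classical_set_scope.
Local Open Scope ring_scope.

Section MatrixLieAlgebras.
Variables (R : realType) (n : nat).
Local Notation M := 'M[R]_n.+1.

Definition identity_component (G : set M) : set M :=
  connected_component G 1%:M.

(* The Lie algebra of a closed matrix group G, as the tangent space of G at
   the identity: the velocities at time 0 of the curves in G through 1.  For a
   closed subgroup of GL, differentiability of the curve at 0 is enough: such
   velocities are already those of the one-parameter subgroups of G. *)
Definition lie_algebra (G : set M) : set M :=
  [set X | exists gamma : R -> M,
    [/\ forall t, G (gamma t), gamma 0 = 1%:M & is_derive (0 : R) 1 gamma X]].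

Definition lie_bracket (X Y : M) : M := X *m Y - Y *m X.

Definition linear_span (A : set M) : set M :=
  [set Z | exists (k : nat) (a : 'I_k -> R) (x : 'I_k -> M),
    (forall i, A (x i)) /\ Z = \sum_(i < k) a i *: x i].

Definition bracket_span (A B : set M) : set M :=
  linear_span [set Z | exists X Y, [/\ A X, B Y & Z = lie_bracket X Y]].

(* sigma is only relevant on g; its values elsewhere are unconstrained. *)
Record involutive_automorphism (g : set M) (sigma : M -> M) : Prop := {
  inv_aut_stable : forall X, g X -> g (sigma X);
  inv_aut_linear : forall (a : R) X Y, g X -> g Y ->
    sigma (a *: X + Y) = a *: sigma X + sigma Y;
  inv_aut_bracket : forall X Y, g X -> g Y ->
    sigma (lie_bracket X Y) = lie_bracket (sigma X) (sigma Y);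
  inv_aut_involutive : forall X, g X -> sigma (sigma X) = X }.

Definition eigenspace_on (g : set M) (sigma : M -> M) (a : R) : set M :=
  [set X | g X /\ sigma X = a *: X].

End MatrixLieAlgebras.

Section AntiDeSitter.
Variables (R : realType) (l : nat).

(* The Gram matrix diag(1, 1, -1, ..., -1) of R^{2,l-1}, of size l + 1. *)
Definition gram2 : 'M[R]_l.+1 :=
  diag_mx (\row_(i < l.+1) (if (i < 2)%N then 1 else -1)).

Definition sqnorm2 (v : 'cV[R]_l.+1) : R := (v^T *m gram2 *m v) 0 0.

Definition SO2 : set 'M[R]_l.+1 :=
  [set A | A^T *m gram2 *m A = gram2 /\ \det A = 1].

Definition groupG : set 'M[R]_l.+1 := identity_component SO2.

Definition groupH (v : 'cV[R]_l.+1) : set 'M[R]_l.+1 :=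
  identity_component [set A | groupG A /\ A *m v = v].

Definition algG : set 'M[R]_l.+1 := lie_algebra groupG.

Definition algH (v : 'cV[R]_l.+1) : set 'M[R]_l.+1 := lie_algebra (groupH v).

End AntiDeSitter.

Arguments algG : clear implicits.

(* Main.v *)
(* Let J be the Gram matrix.  The Cayley transform shows that the Lie algebra of
   SO(J)_0 is so(J) = {X | X^T J + J X = 0}.  For X, Y, Z in q, the number
   <Zv, X(Yv)> is symmetric in (X, Y), because [X, Y] lies in h and so kills v,
   and antisymmetric in (Y, Z), because X is skew; hence it vanishes.  As q -> v^⊥,
   X |-> Xv is onto, this forces X = (Xv) ∧ v, so q = {x ∧ v | x ⊥ v}.  Finally
   [x ∧ v, y ∧ v] = - x ∧ y, and the x ∧ y with x, y ⊥ v span h. *)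
Require Import Defs.
From mathcomp Require Import all_boot all_order all_algebra.
From mathcomp Require Import all_classical all_reals all_analysis.
From mathcomp Require Import ring.
Import Order.TTheory GRing.Theory Num.Theory.
Import numFieldNormedType.Exports.
Local Open Scope classical_set_scope.
Local Open Scope ring_scope.

Set Implicit Arguments.
Unset Strict Implicit.

Lemma is_derive_mxP (R : realType) (V : normedModType R) (m n : nat)
    (M : V -> 'M[R]_(m, n)) (t v : V) (dM : 'M[R]_(m, n)) :
  is_derive t v M dM <->
  forall i j, is_derive t v (fun x => M x i j) (dM i j).
Proof.
split=> [[dvM <-] i j|dvM].
  by rewrite derive_mx // mxE; apply: derivableP; move/derivable_mxP: dvM.
have dM' : derivable M t v by apply/derivable_mxP => i j; case: (dvM i j).
apply: DeriveDef => //; rewrite derive_mx //; apply/matrixP => i j.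
by rewrite mxE; case: (dvM i j).
Qed.

Lemma is_derive_mulmx (R : realType) (V : normedModType R) (m n p : nat)
    (M : V -> 'M[R]_(m, n)) (N : V -> 'M[R]_(n, p)) (t v : V)
    (dM : 'M[R]_(m, n)) (dN : 'M[R]_(n, p)) :
  is_derive t v M dM -> is_derive t v N dN ->
  is_derive t v (fun x => M x *m N x) (M t *m dN + dM *m N t).
Proof.
move=> /is_derive_mxP hM /is_derive_mxP hN; apply/is_derive_mxP => i j.
rewrite (_ : (fun x => _) =
    \sum_k ((fun x => M x i k) * (fun x => N x k j))); last first.
  by apply/funext => x; rewrite mxE fct_sumE.
rewrite !mxE -big_split /=; apply: is_derive_eq.
by apply: eq_bigr => k _; rewrite /GRing.scale /= [N t k j * _]mulrC.
Qed.

Lemma is_derive_trmx (R : realType) (V : normedModType R) (m n : nat)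
    (M : V -> 'M[R]_(m, n)) (t v : V) (dM : 'M[R]_(m, n)) :
  is_derive t v M dM -> is_derive t v (fun x => (M x)^T) dM^T.
Proof.
move=> /is_derive_mxP hM; apply/is_derive_mxP => i j.
by under eq_fun do rewrite mxE; rewrite mxE.
Qed.

Lemma derivable_horner_mx (R : realType) (m n : nat) (P : 'M[{poly R}]_(m, n))
    (t : R) : derivable (fun s : R => map_mx (horner_eval s) P) t 1.
Proof.
apply/derivable_mxP => i j; under eq_fun do rewrite mxE.
exact: derivable_horner.
Qed.

Lemma derivable_horner_invmx (R : realType) (n : nat) (P : 'M[{poly R}]_n)
    (t : R) :
  (forall s, map_mx (horner_eval s) P \in unitmx) ->
  derivable (fun s : R => invmx (map_mx (horner_eval s) P)) t 1.
Proof.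
move=> uP; apply/derivable_mxP => i j.
rewrite (_ : (fun s => _) =
    ((fun s => ((\det P).[s])^-1) * horner (\adj P i j))); last first.
  apply/funext => s; rewrite /invmx uP -map_mx_adj det_map_mx !mxE.
  by rewrite /horner_eval.
apply: derivableM; last exact: derivable_horner.
apply: derivableV; last exact: derivable_horner.
by have := uP t; rewrite unitmxE det_map_mx unitfE.
Qed.

(* t / (1 + c t^2) is bounded by 1 / (2 sqrt c), so a large c keeps 1 - s X
   invertible at s = t / (1 + c t^2). *)
Lemma poly_resolvent_unit (R : realType) (n : nat) (X : 'M[R]_n) :
  exists2 c : R, 0 <= c & forall t : R, (1 + c * t ^+ 2)%:M - t *: X \in unitmx.
Proof.
pose p : {poly R} := \det (1%:M - 'X *: map_mx polyC X).
have pE s : p.[s] = \det (1%:M - s *: X).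
  rewrite -/(horner_eval s p) /p -det_map_mx; congr (\det _).
  apply/matrixP => i j; rewrite !mxE rmorphB rmorphM rmorph_nat /=.
  by rewrite /horner_eval hornerX hornerC.
have p0 : p.[0] = 1 by rewrite pE scale0r subr0 det1.
have /cvgrPdist_lt /(_ 1 ltr01) : horner p x @[x --> (0 : R)] --> horner p 0.
  exact: continuous_horner.
move=> /nbhs_ballP[d /= d0 dP]; exists (d ^- 2) => [|t].
  by rewrite invr_ge0 exprn_ge0 // ltW.
set a := 1 + _.
have a0 : 0 < a by rewrite ltr_pwDl // mulr_ge0 ?sqr_ge0 // invr_ge0 sqr_ge0.
have td : `|t / a| < d.
  rewrite normrM normfV (gtr0_norm a0) ltr_pdivrMr // /a.
  have -> : t ^+ 2 = `|t| ^+ 2 by rewrite real_normK ?num_real.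
  have -> : d * (1 + d ^- 2 * `|t| ^+ 2) = d + `|t| ^+ 2 / d.
    by field; rewrite gt_eqF.
  rewrite -subr_gt0.
  have -> : d + `|t| ^+ 2 / d - `|t| =
      ((d - `|t| / 2) ^+ 2 + 3 / 4 * `|t| ^+ 2) / d.
    by field; rewrite gt_eqF.
  rewrite divr_gt0 //.
  have [->|t0] := eqVneq `|t| 0.
    by rewrite mul0r subr0 expr0n /= mulr0 addr0 exprn_gt0.
  by rewrite ltr_wpDl ?sqr_ge0 // mulr_gt0 // exprn_even_gt0.
have -> : a%:M - t *: X = a *: (1%:M - (t / a) *: X).
  by rewrite scalerBr scalerA mulrCA divff ?gt_eqF // mulr1 scalemx1.
rewrite unitmxZ ?unitfE ?gt_eqF // unitmxE unitfE -pE; apply/eqP => pt.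
have := dP (t / a); rewrite /ball /= sub0r normrN => /(_ td).
by rewrite pt p0 subr0 normr1 ltxx.
Qed.

Definition so_alg (R : realType) (n : nat) (J : 'M[R]_n) : set 'M[R]_n :=
  [set X | X^T *m J + J *m X = 0].

Definition SO_form (R : realType) (n : nat) (J : 'M[R]_n) : set 'M[R]_n :=
  [set A | A^T *m J *m A = J /\ \det A = 1].

Lemma lie_algebra_SO_sub (R : realType) (n : nat) (J X : 'M[R]_n.+1) :
  lie_algebra (identity_component (SO_form J)) X -> so_alg J X.
Proof.
case=> g [gG g0 dg].
have dJ : is_derive (0 : R) 1 (fun t => (g t)^T *m J *m g t) 0.
  rewrite (_ : (fun t => _) = cst J); first exact: is_derive_cst.
  by apply/funext => t; case: (connected_component_sub (gG t)).
have := is_derive_mulmx (is_derive_mulmx (is_derive_trmx dg)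
  (is_derive_cst J (0 : R) 1)) dg.
move=> /@derive_val; rewrite /cst /= !g0  trmx1 !mul1mx mulmx1 add0r.
by rewrite addrC => DJ; rewrite /so_alg /= -DJ; case: dJ.
Qed.

Lemma lie_algebra_SO (R : realType) (n : nat) (J : 'M[R]_n.+1) :
  J \in unitmx -> lie_algebra (identity_component (SO_form J)) = so_alg J.
Proof.
move=> uJ; apply/seteqP; split=> X; first exact: lie_algebra_SO_sub.
rewrite /so_alg /= => soX.
have [Y XY] : exists Y, X = Y + Y.
  exists (2^-1 *: X).
  by rewrite -mulr2n -scaler_nat scalerA divff ?scale1r // pnatr_eq0.
have [c c0 uB] := poly_resolvent_unit Y.
have soY : Y^T *m J = - (J *m Y).
  apply/eqP; rewrite -addr_eq0; apply/eqP/(scalerI (lt0r_neq0 (ltr0Sn R 1))).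
  rewrite scaler0 scaler_nat mulr2n -{}soX XY linearD.
  by rewrite mulmxDl mulmxDr addrACA.
(* The curve is the Cayley transform (a + tY) / (a - tY) with a = 1 + c t^2; its
   entries are rational in t, without poles. *)
pose a t : R := 1 + c * t ^+ 2.
pose P : 'M[{poly R}]_n.+1 :=
  (1 + c%:P * 'X ^+ 2)%:M - 'X *: map_mx polyC Y.
pose Q : 'M[{poly R}]_n.+1 :=
  (1 + c%:P * 'X ^+ 2)%:M + 'X *: map_mx polyC Y.
have PE t : map_mx (horner_eval t) P = (a t)%:M - t *: Y.
  apply/matrixP => i j; rewrite !mxE rmorphB rmorphM rmorphMn /= /horner_eval.
  by rewrite !hornerE /a expr2 mulrA.
have QE t : map_mx (horner_eval t) Q = (a t)%:M + t *: Y.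
  apply/matrixP => i j; rewrite !mxE rmorphD rmorphM rmorphMn /= /horner_eval.
  by rewrite !hornerE /a expr2 mulrA.
have uP s : map_mx (horner_eval s) P \in unitmx by rewrite PE /a.
pose g (t : R) := invmx (map_mx (horner_eval t) P) *m map_mx (horner_eval t) Q.
have dg t : derivable g t 1.
  by case: (is_derive_mulmx (derivableP (@derivable_horner_invmx _ _ P t uP))
                            (derivableP (@derivable_horner_mx _ _ _ Q t))).
have g0 : g 0 = 1%:M.
  have := uP 0; rewrite /g PE QE !scale0r subr0 addr0; exact: mulVmx.
have PQ t : map_mx (horner_eval t) P *m map_mx (horner_eval t) Q =
            map_mx (horner_eval t) Q *m map_mx (horner_eval t) P.
  rewrite PE QE !(mulmxDl, mulmxDr, mulNmx, mulmxN).
  by rewrite -!scalemxAl -!scalemxAr !scalar_mxC; apply/matrixP => i j;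
     rewrite !mxE; ring.
have PJ t : (map_mx (horner_eval t) P)^T *m J =
            J *m map_mx (horner_eval t) Q.
  rewrite PE QE linearB linearZ /= tr_scalar_mx mulmxBl mulmxDr -scalemxAl soY.
  by rewrite scalerN opprK -scalemxAr scalar_mxC.
have QJ t : (map_mx (horner_eval t) Q)^T *m J =
            J *m map_mx (horner_eval t) P.
  rewrite PE QE linearD linearZ /= tr_scalar_mx mulmxDl mulmxBr -scalemxAl soY.
  by rewrite scalerN -scalemxAr scalar_mxC.
have Pg t : map_mx (horner_eval t) P *m g t = map_mx (horner_eval t) Q.
  by rewrite /g mulKVmx.
have gP t : g t *m map_mx (horner_eval t) P = map_mx (horner_eval t) Q.
  by rewrite /g -mulmxA -PQ mulKmx.
move: g dg g0 Pg gP => {PQ} g dg g0 Pg gP.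
have gSO t : SO_form J (g t).
  split.
    apply: (can_inj (mulmxK (uP t))).
    by rewrite /= -[LHS]mulmxA gP -[LHS]mulmxA -PJ mulmxA -trmx_mul Pg QJ.
  have detPQ : \det (map_mx (horner_eval t) P) =
      \det (map_mx (horner_eval t) Q).
    have := congr1 determinant (PJ t).
    rewrite !det_mulmx det_tr mulrC; apply: mulfI.
    by rewrite -unitfE -unitmxE.
  have uPt : \det (map_mx (horner_eval t) P) != 0 by rewrite -unitfE -unitmxE.
  by apply: (mulfI uPt); rewrite mulr1 -det_mulmx Pg.
have gc : continuous g.
  by move=> t; exact/differentiable_continuous/derivable1_diffP.
exists g; split=> //.
  move=> t; apply: (@connected_component_max _ _ (range g)); last by exists t.
  - by exists 0.
  - by move=> _ [s _ <-].
  apply: connected_continuous_connected; last exact: continuous_subspaceT.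
  exact/connected_intervalP.
have dP : is_derive (0 : R) 1 (fun t : R => map_mx (horner_eval t) P) (- Y).
  apply/is_derive_mxP => i j; under eq_fun do rewrite mxE.
  apply: is_derive_eq.
  rewrite !mxE derivB derivM derivMn derivD derivM !derivC derivXn derivX.
  by rewrite !hornerE hornerMn !hornerE mul0rn sub0r.
have dQ : is_derive (0 : R) 1 (fun t : R => map_mx (horner_eval t) Q) Y.
  apply/is_derive_mxP => i j; under eq_fun do rewrite mxE.
  apply: is_derive_eq.
  rewrite !mxE derivD derivM derivMn derivD derivM !derivC derivXn derivX.
  by rewrite !hornerE hornerMn !hornerE mul0rn /= addr0 add0r.
apply: DeriveDef => //.
have := is_derive_mulmx dP (derivableP (dg 0)).
rewrite (_ : (fun t : R => _) = (fun t : R => map_mx (horner_eval t) Q));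
  last exact/funext.
move=> /@derive_val; case: dQ => _ -> .
rewrite g0 PE scale0r subr0 /a expr0n /= mulr0 addr0 mul1mx mulmx1 => YE.
by rewrite XY {1}YE subrK.
Qed.

Lemma so_alg_lin (R : realType) (n : nat) (J : 'M[R]_n) (a : R)
    (X Y : 'M[R]_n) :
  so_alg J X -> so_alg J Y -> so_alg J (a *: X + Y).
Proof.
rewrite /so_alg /= => sX sY.
rewrite linearP /= mulmxDl mulmxDr -scalemxAl -scalemxAr addrACA -scalerDr.
by rewrite sX sY scaler0 addr0.
Qed.

Lemma so_algP (R : realType) (n : nat) (J X : 'M[R]_n) :
  so_alg J X <-> X^T *m J = - (J *m X).
Proof.
by rewrite /so_alg /=; split=> [/eqP|->]; rewrite ?addNr // addr_eq0 => /eqP.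
Qed.

Lemma so_alg_bracket (R : realType) (n : nat) (J X Y : 'M[R]_n.+1) :
  so_alg J X -> so_alg J Y -> so_alg J (lie_bracket X Y).
Proof.
move=> /so_algP sX /so_algP sY; apply/so_algP.
rewrite /lie_bracket linearB /= !trmx_mul mulmxBl mulmxBr -!mulmxA sX sY.
by rewrite !mulmxN !mulmxA sX sY !mulNmx !opprK opprB.
Qed.

Lemma trmx11 (R : realType) (A : 'M[R]_1) : A^T = A.
Proof. by rewrite (mx11_scalar A) tr_scalar_mx. Qed.

Definition wedge (R : realType) (n : nat) (J : 'M[R]_n) (x y : 'cV[R]_n) :
    'M[R]_n := x *m y^T *m J - y *m x^T *m J.

Section SymmetricForm.
Variables (R : realType) (n : nat) (J : 'M[R]_n.+1).
Hypotheses (Jsym : J^T = J) (Junit : J \in unitmx).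

Lemma form_sym (x y : 'cV[R]_n.+1) : x^T *m J *m y = y^T *m J *m x.
Proof. by rewrite -[LHS]trmx11 !trmx_mul trmxK Jsym mulmxA. Qed.

Lemma so_alg_wedge (x y : 'cV[R]_n.+1) : so_alg J (wedge J x y).
Proof.
apply/so_algP; rewrite /wedge linearB /= !trmx_mul !trmxK Jsym.
by rewrite mulmxBl mulmxBr opprB !mulmxA.
Qed.

Lemma so_alg_form (X : 'M[R]_n.+1) (x y : 'cV[R]_n.+1) : so_alg J X ->
  x^T *m J *m X *m y = - (y^T *m J *m X *m x).
Proof.
move=> /so_algP sX.
rewrite -[LHS]trmx11 !trmx_mul trmxK Jsym -!mulmxA.
by rewrite [X^T *m _]mulmxA sX mulNmx mulmxN !mulmxA.
Qed.

Variable v : 'cV[R]_n.+1.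
Hypothesis v1 : v^T *m J *m v = 1%:M.

Definition orth_proj : 'M[R]_n.+1 := 1%:M - v *m v^T *m J.

Lemma orth_proj_orth (x : 'cV[R]_n.+1) : v^T *m J *m (orth_proj *m x) = 0.
Proof.
rewrite /orth_proj mulmxBl mul1mx mulmxBr !mulmxA v1 mul1mx.
by rewrite subrr.
Qed.

Lemma so_alg_mul_orth (X : 'M[R]_n.+1) : so_alg J X -> v^T *m J *m (X *m v) = 0.
Proof.
move=> sX; apply: (scalerI (lt0r_neq0 (ltr0Sn R 1))).
rewrite scaler0 scaler_nat mulr2n mulmxA {1}(so_alg_form v v sX).
exact: addNr.
Qed.

Lemma wedge_mul (x : 'cV[R]_n.+1) : v^T *m J *m x = 0 -> wedge J x v *m v = x.
Proof.
move=> xv; rewrite /wedge mulmxBl -!mulmxA [v^T *m _]mulmxA v1 mulmx1.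
by rewrite [x^T *m _]mulmxA (form_sym x v) xv mulmx0 subr0.
Qed.

(* Curvature of the quadric <x, x> = 1 at v. *)
Lemma bracket_wedge (x y : 'cV[R]_n.+1) :
  v^T *m J *m x = 0 -> v^T *m J *m y = 0 ->
  lie_bracket (wedge J x v) (wedge J y v) = - wedge J x y.
Proof.
move=> xv yv.
have mulw (a b : 'cV[R]_n.+1) : v^T *m J *m a = 0 -> v^T *m J *m b = 0 ->
    wedge J a v *m wedge J b v =
    - (a *m b^T *m J) - v *m (a^T *m J *m b) *m v^T *m J.
  move=> av bv; rewrite /wedge mulmxBl !mulmxBr.
  have assoc (p q : 'cV[R]_n.+1) (r s : 'rV[R]_n.+1) :
      p *m r *m (q *m s) = p *m (r *m q) *m s by rewrite !mulmxA.
  rewrite -!(mulmxA _ _ J) !assoc bv v1 mulmx0 mul0mx sub0r mulmx1.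
  by rewrite (form_sym a v) av mulmx0 mul0mx subr0.
rewrite /lie_bracket !mulw // (form_sym y x) /wedge.
by rewrite opprD opprK addrACA opprK addNr addr0 opprB addrC.
Qed.

Lemma sum_col_mul (p : nat) (A B : 'M[R]_(n.+1, p)) :
  \sum_i col i A *m (col i B)^T = A *m B^T.
Proof.
apply/matrixP => i j; rewrite summxE mxE; apply: eq_bigr => k _.
by rewrite !mxE big_ord1 !mxE.
Qed.

Lemma so_alg_sum_wedge (A : 'M[R]_n.+1) : so_alg J A -> A *m v = 0 ->
  A = \sum_i 2^-1 *: wedge J (col i (A *m invmx J)) (col i orth_proj).
Proof.
move=> /so_algP sA Av.
have sS : (A *m invmx J)^T = - (A *m invmx J).
  apply: (can_inj (mulmxK Junit)); apply: (can_inj (mulKmx Junit)).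
  rewrite trmx_mul trmx_inv Jsym mulNmx mulmxN mulmxKV // !mulmxA.
  by rewrite mulmxV // mul1mx sA.
rewrite -scaler_sumr sumrB.
rewrite -!mulmx_suml !sum_col_mul sS mulmxN mulNmx opprK.
have -> : A *m invmx J *m orth_proj^T *m J = A.
  rewrite /orth_proj linearB /= trmx1 !trmx_mul trmxK Jsym mulmxBr.
  rewrite mulmx1 !mulmxA.
  by rewrite mulmxKV // Av mul0mx subr0 mulmxKV.
rewrite mulmxA mulmxKV // /orth_proj mulmxBl mul1mx.
have -> : v *m v^T *m J *m A = 0.
  have JA : J *m A = - (A^T *m J) by rewrite sA opprK.
  by rewrite -mulmxA JA mulmxN mulmxA -(mulmxA v) -trmx_mul Av trmx0 mulmx0
    mul0mx oppr0.
by rewrite subr0 -[A in A + A]scale1r -scalerDl scalerA mulVf ?scale1r.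
Qed.

Lemma so_alg_eq_wedge (X : 'M[R]_n.+1) : so_alg J X ->
  (forall x y : 'cV[R]_n.+1,
     (orth_proj *m x)^T *m J *m X *m (orth_proj *m y) = 0) ->
  X = wedge J (X *m v) v.
Proof.
move=> sX X0.
have PXP : orth_proj^T *m J *m X *m orth_proj = 0.
  set M := LHS.
  have M0 (a b : 'cV[R]_n.+1) : a^T *m M *m b = 0.
    by rewrite /M !mulmxA -trmx_mul -[LHS]mulmxA X0.
  move: M M0 => M M0; apply/matrixP => i j.
  have /matrixP /(_ 0 0) := M0 (delta_mx i 0) (delta_mx j 0).
  by rewrite trmx_delta -rowE -colE !mxE.
have PJ : orth_proj^T *m J = J *m orth_proj.
  rewrite /orth_proj linearB /= trmx1 !trmx_mul trmxK Jsym mulmxBl mulmxBr.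
  by rewrite mul1mx mulmx1 !mulmxA.
have {}PXP : orth_proj *m X *m orth_proj = 0.
  apply: (can_inj (mulKmx Junit)).
  by rewrite mulmx0 !mulmxA -PJ.
have vXv := so_alg_mul_orth sX.
have vX : v^T *m J *m X = - ((X *m v)^T *m J).
  move/so_algP: sX => sX; rewrite trmx_mul -(mulmxA v^T X^T) sX.
  by rewrite mulmxN opprK mulmxA.
move: PXP; rewrite /orth_proj mulmxBl mul1mx mulmxBr mulmx1 mulmxBl.
rewrite -!(mulmxA v) vX.
have xv : (X *m v)^T *m J *m v = 0 by rewrite (form_sym (X *m v) v).
have xvv : (X *m v)^T *m J *m (v *m (v^T *m J)) = 0.
  by rewrite mulmxA xv mul0mx.
rewrite !(mulmxN, mulNmx) xvv mulmx0 oppr0 opprK subr0 (mulmxA X) => /eqP.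
by rewrite subr_eq0 => /eqP XE; rewrite /wedge -!(mulmxA _ _ J) -XE addrK.
Qed.

End SymmetricForm.

Lemma gram2_tr (R : realType) (l : nat) : (gram2 R l)^T = gram2 R l.
Proof. by rewrite tr_diag_mx. Qed.

Lemma gram2_unit (R : realType) (l : nat) : gram2 R l \in unitmx.
Proof.
rewrite unitmxE det_diag unitfE; apply/prodf_neq0 => i _.
rewrite mxE; case: ifP => _; first exact: oner_neq0.
by rewrite oppr_eq0 oner_neq0.
Qed.

Lemma algG_so (R : realType) (l : nat) : algG R l = so_alg (gram2 R l).
Proof. exact: lie_algebra_SO (gram2_unit R l). Qed.

Lemma algH_fix (R : realType) (l : nat) (v : 'cV[R]_l.+1) (X : 'M[R]_l.+1) :
  algH v X -> X *m v = 0.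
Proof.
case=> g [gH _ dg].
have := is_derive_mulmx dg (is_derive_cst v (0 : R) 1).
rewrite (_ : (fun t => _) = cst v); last first.
  by apply/funext => t; case: (connected_component_sub (gH t)).
rewrite /cst mulmx0 add0r => /@derive_val <-.
exact: derive_cst.
Qed.

Theorem proposition57 (R : realType) (l : nat) (hl : (3 <= l)%N)
    (v : 'cV[R]_l.+1) (hv : sqnorm2 v = 1)
    (sigma : 'M[R]_l.+1 -> 'M[R]_l.+1)
    (hsigma : involutive_automorphism (algG R l) sigma)
    (hfix : eigenspace_on (algG R l) sigma 1 = algH v) :
  let q := eigenspace_on (algG R l) sigma (-1) in
  algH v = bracket_span q q.
Proof.
set J := gram2 R l; move=> q.
have Jsym : J^T = J := gram2_tr R l.
have Junit : J \in unitmx := gram2_unit R l.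
have v1 : v^T *m J *m v = 1%:M by rewrite [LHS]mx11_scalar; congr (_%:M).
move: hfix hsigma @q; rewrite algG_so -/J => hfix [stab lin brk invol] q.
have sigmaN X : q X -> sigma X = - X by case=> _ ->; rewrite scaleN1r.
have sigmaD X Y : so_alg J X -> so_alg J Y -> sigma (X + Y) = sigma X + sigma Y.
  by have := lin 1 X Y; rewrite !scale1r.
have so0 : so_alg J (0 : 'M[R]_l.+1).
  by apply/so_algP; rewrite trmx0 mul0mx mulmx0 oppr0.
have sigma0 : sigma 0 = 0.
  by apply: (addrI (sigma 0)); rewrite -sigmaD // !addr0.
have soD X Y : so_alg J X -> so_alg J Y -> so_alg J (X + Y).
  by move=> gX gY; have := so_alg_lin 1 gX gY; rewrite scale1r.
have soZ (a : R) X : so_alg J X -> so_alg J (a *: X).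
  by move=> gX; rewrite -[a *: X]addr0; apply: so_alg_lin.
have sigmaZ a X : so_alg J X -> sigma (a *: X) = a *: sigma X.
  by move=> gX; rewrite -[a *: X]addr0 lin // sigma0 addr0.
have qq X Y : q X -> q Y -> algH v (lie_bracket X Y).
  move=> qX qY; rewrite -hfix; split.
    by apply: so_alg_bracket; [case: qX|case: qY].
  rewrite brk; [|by case: qX|by case: qY].
  by rewrite !sigmaN // /lie_bracket !mulNmx !mulmxN !opprK scale1r.
have qsurj x : v^T *m J *m x = 0 -> exists2 Y, q Y & Y *m v = x.
  move=> vx; have := wedge_mul Jsym v1 vx.
  move: (wedge J x v) (so_alg_wedge Jsym x v) => W gW Wv.
  have gsW := stab _ gW.
  have gm : so_alg J (W - sigma W).
    by rewrite -scaleN1r addrC; exact: so_alg_lin.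
  have gp := soD _ _ gW gsW.
  have smW : sigma (W - sigma W) = - (W - sigma W).
    have gN : so_alg J (- sigma W) by rewrite -scaleN1r; exact: soZ.
    rewrite sigmaD //.
    by rewrite -[X in _ + sigma X]scaleN1r sigmaZ // invol // scaleN1r opprB.
  have spW : (W + sigma W) *m v = 0.
    apply: algH_fix; rewrite -hfix; split=> //.
    by rewrite sigmaD // invol // scale1r addrC.
  exists (2^-1 *: (W - sigma W)).
    by split; [exact: soZ|rewrite sigmaZ // smW scaleN1r scalerN].
  have : (W - sigma W) *m v = 2 *: x.
    have /eqP := spW; rewrite mulmxDl Wv addr_eq0 => /eqP xE.
    by rewrite mulmxBl Wv -xE scaler_nat mulr2n.
  by rewrite -scalemxAl => ->; rewrite scalerA mulVf ?scale1r.
pose T (Z X Y : 'M[R]_l.+1) : 'M[R]_1 := (Z *m v)^T *m J *m X *m (Y *m v).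
have T_sym X Y Z : q X -> q Y -> T Z X Y = T Z Y X.
  move=> qX qY; have := algH_fix (qq _ _ qX qY).
  rewrite mulmxBl => /eqP; rewrite subr_eq0 -!mulmxA => /eqP XY.
  by rewrite /T -[LHS]mulmxA XY !mulmxA.
have T_anti X Y Z : q X -> T Z X Y = - T Y X Z.
  by case=> gX _; rewrite /T so_alg_form.
have T0 X Y Z : q X -> q Y -> q Z -> T Z X Y = 0.
  move=> qX qY qZ.
  have TN : T Z X Y = - T Z X Y.
    rewrite {1}(T_sym X Y Z) // (T_anti Y X Z) // (T_sym Y Z X) //.
    by rewrite (T_anti Z Y X) // (T_sym Z X Y) // (T_anti X Z Y) // opprK.
  apply: (scalerI (lt0r_neq0 (ltr0Sn R 1))).
  by rewrite scaler0 scaler_nat mulr2n {2}TN subrr.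
have qE X : q X -> X = wedge J (X *m v) v.
  move=> qX; apply: so_alg_eq_wedge => //; first by case: qX.
  move=> x y.
  have [Z qZ <-] := qsurj _ (orth_proj_orth v1 x).
  have [Y qY <-] := qsurj _ (orth_proj_orth v1 y).
  exact: T0.
have qwedge x : v^T *m J *m x = 0 -> q (wedge J x v).
  by move=> vx; have [Y qY <-] := qsurj _ vx; rewrite -qE.
apply/seteqP; split=> [A hA|_ [k [a [x [hx ->]]]]].
  have sA : so_alg J A by move: hA; rewrite -hfix => -[].
  have Av := algH_fix hA.
  exists l.+1, (fun=> - 2^-1),
    (fun i => - wedge J (col i (A *m invmx J)) (col i (orth_proj J v))).
  split=> [i|]; last first.
    rewrite [LHS](so_alg_sum_wedge Jsym Junit sA Av).
    by apply: eq_bigr => i _; rewrite scalerN scaleNr opprK.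
  have vS : v^T *m J *m col i (A *m invmx J) = 0.
    have /so_algP AJ := sA.
    have JA : J *m A = - (A^T *m J) by rewrite AJ opprK.
    rewrite colE !mulmxA -(mulmxA v^T) JA mulmxN mulmxA -trmx_mul Av.
    by rewrite trmx0 mul0mx oppr0 !mul0mx.
  have vP : v^T *m J *m col i (orth_proj J v) = 0.
    by rewrite colE; exact: orth_proj_orth.
  exists (wedge J (col i (A *m invmx J)) v),
    (wedge J (col i (orth_proj J v)) v).
  by rewrite bracket_wedge //; split=> //; exact: qwedge.
rewrite -hfix.
apply: (big_ind (eigenspace_on (so_alg J) sigma 1)).
- by split=> //; rewrite sigma0 scaler0.
- move=> X Y [gX sX] [gY sY]; split; last by rewrite sigmaD // sX sY !scale1r.
  exact: soD.
move=> i _; have [X [Y [qX qY ->]]] := hx i.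
have := qq _ _ qX qY; rewrite -hfix => -[gZ sZ].
by split; [exact: soZ|rewrite sigmaZ // sZ !scale1r].
Qed.
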